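(* Given a metric space $X$ admitting a geometric tree-like decomposition $\{X_n\}_{n\in N}$, the space $\mathrm{Lip}_0(X)$ is weak*-isomorphic to the $\ell^\infty$-sum $\bigoplus^\infty_{n\in N}\mathrm{Lip}_0(X_n)$.
   Context: Tree-like decompositions. Let $N=\{0,1,\dots,\max(N)\}$ or $N=\mathbb{N}=\{0,1,2,\dots\}$. A family $\{X_n\}_{n\in N}$ of subsets of $X$ is a tree-like decomposition of $X$ if $X=\bigcup_{n\in N}X_n$ and, for each $n\in N\setminus\{0\}$, the set $X_n\cap\bigcup_{m<n}X_m$ consists of exactly one point $p_n$; the $p_n$ are called branch points. A decomposition path from $x$ to $y$ is a finite sequence $(z_i)_{i\in I}$, $I=\{0,\dots,\max(I)\}$, with $z_0=x$, $z_{\max(I)}=y$, with $z_i$ a branch point for $1\le i\le\max(I)-1$, and such that for each $1\le i\le\max(I)$ there is $n_i\in N$ with $\{z_{i-1},z_i\}\subset X_{n_i}$. It is minimal if there is no proper subset $I'\subsetneq I$ such that $(z_i)_{i\in I'}$ is a decomposition path from $z_0$ to $z_{\max(I)}$. For $C\ge1$, $\{X_n\}_{n\in N}$ is a $C$-geometric tree-like decomposition of the metric space $X$ if (1) it is a tree-like decomposition; (2) for any minimal decomposition path $(z_i)_{i\in I}$, $d(z_0,z_{\max(I)})\le C\max_{i<\max(I)}d(z_i,z_{i+1})$; (3) for all $x,y\in X$ there is a decomposition path $(z_i)_{i\in I}$ from $x$ to $y$ with $C^{-1}\sum_{i<\max(I)}d(z_i,z_{i+1})\le d(x,y)$. It is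 geometric if it is $C$-geometric for some $C\ge 1$. For a metric space $X$ with a basepoint $x_0$, $\mathrm{Lip}_0(X)$ is the Banach space of Lipschitz $f:X\to\mathbb{R}$ with $f(x_0)=0$, normed by the optimal Lipschitz constant; its canonical predual is the Lipschitz free space $\mathcal{F}(X)$ (closed span of point evaluations in $\mathrm{Lip}_0(X)^*$). The $\ell^\infty$-sum $\bigoplus_n^\infty\mathrm{Lip}_0(X_n)$ has canonical predual the $\ell^1$-sum $\bigoplus_n^1\mathcal{F}(X_n)$. A weak*-isomorphism is a bounded linear bijection with bounded inverse that is continuous for the weak*-topologies induced by the canonical preduals. Each $X_n$ carries the restricted metric and some basepoint. *)

(* Defs.v *)
(* MathComp-Analysis world, over an arbitrary [R : realType]. *)
From HB Require Import structures.
From mathcomp Require Import all_boot all_order all_algebra.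
From mathcomp Require Import all_classical all_reals all_analysis.

Set Implicit Arguments.
Unset Strict Implicit.
Unset Printing Implicit Defensive.

Import Order.TTheory GRing.Theory Num.Theory.
Import numFieldNormedType.Exports.

Local Open Scope classical_set_scope.
Local Open Scope ring_scope.

Section subset_metric.
Context (R : realType) (X : metricType R) (A : set X).

Definition subset_dist (x y : A) : R := mdist (val x) (val y).

Let subset_dist_ge0 x y : 0 <= subset_dist x y.
Proof. exact: mdist_ge0. Qed.

Let subset_dist_positivity x y : subset_dist x y = 0 -> x = y.
Proof. by move=> /mdist_positivity/val_inj. Qed.

Let ball_subset_dist (x : A) d : ball x d = [set y | subset_dist x y < d].
Proof.
rewrite -[LHS]/(val @^-1` ball (val x : X) d) ballEmdist.
by apply/seteqP; split.
Qed.

HB.instance Definition _ := PseudoMetric_isMetric.Build R (A : Type)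
  subset_dist_ge0 subset_dist_positivity ball_subset_dist.

End subset_metric.

Section tree_like_decompositions.
Context (R : realType) (X : metricType R) (N : set nat) (Xs : nat -> set X).

Definition initial_segment := N = setT \/ exists m, N = `I_m.+1.

Definition meets_previous_at n p :=
  Xs n `&` \bigcup_(m < n) Xs m = [set p].

Definition branch_point p :=
  exists n, [/\ N n, (0 < n)%N & meets_previous_at n p].

Definition tree_like_decomposition :=
  [/\ initial_segment,
      \bigcup_(n in N) Xs n = setT &
      forall n, N n -> (0 < n)%N -> exists p, meets_previous_at n p].

(* A sequence indexed by [{0, ..., max I}] is a nonempty list [z], with
   [max I = (size z).-1]; [x] is also the irrelevant default of [nth]. *)
Definition decomposition_path (x y : X) (z : seq X) :=
  let z_ := nth x z in
  [/\ (0 < size z)%N, z_ 0%N = x, z_ (size z).-1 = y,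
      forall i, (0 < i < (size z).-1)%N -> branch_point (z_ i) &
      forall i, (i < (size z).-1)%N ->
        exists n, [/\ N n, Xs n (z_ i) & Xs n (z_ i.+1)]].

(* The restrictions of [z] to subsets of its index set are its subsequences. *)
Definition minimal_decomposition_path (x y : X) (z : seq X) :=
  decomposition_path x y z /\
  forall z', subseq z' z -> decomposition_path x y z' -> z' = z.

(* For a one-point path the maximum is over the empty set and equals 0. *)
Definition max_step (x : X) (z : seq X) : R :=
  \big[Num.max/0]_(i < (size z).-1) mdist (nth x z i) (nth x z i.+1).

Definition path_length (x : X) (z : seq X) : R :=
  \sum_(i < (size z).-1) mdist (nth x z i) (nth x z i.+1).

Definition geometric_decomposition_with (C : R) :=
  [/\ tree_like_decomposition,
      forall x y z, minimal_decomposition_path x y z ->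
        mdist x y <= C * max_step x z &
      forall x y, exists2 z, decomposition_path x y z &
        C^-1 * path_length x z <= mdist x y].

Definition geometric_decomposition :=
  exists2 C : R, 1 <= C & geometric_decomposition_with C.

End tree_like_decompositions.

(* Facts shared by the norms below that are defined as the least element of a
   set [B v] of admissible constants. *)
Section least_constant.
Context (R : realType) (V : lmodType R) (B : V -> set R).
Hypothesis B_neq0 : forall v, B v !=set0.
Hypothesis B_ge0 : forall v k, B v k -> 0 <= k.
Hypothesis BP : forall v k, 0 <= k -> (forall e, 0 < e -> B v (k + e)) -> B v k.
Hypothesis BS : forall v k l, B v k -> k <= l -> B v l.
Hypothesis BD : forall u v k l, B u k -> B v l -> B (u + v) (k + l).
Hypothesis BZ : forall a v k, B v k -> B (a *: v) (`|a| * k).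
Hypothesis B_eq0 : forall v, B v 0 -> v = 0.

Let lb v : has_lbound (B v).
Proof. by exists 0 => k /B_ge0. Qed.

Lemma least_constant v : B v (inf (B v)).
Proof.
apply: BP => [|e e0]; first by apply: lb_le_inf => // k /B_ge0.
have [k Bk kl] := inf_adherent e0 (conj (B_neq0 v) (@lb v)).
exact: BS Bk (ltW kl).
Qed.

Lemma least_constant_le v k : B v k -> inf (B v) <= k.
Proof. exact: ge_inf. Qed.

Lemma least_constantD u v : inf (B (u + v)) <= inf (B u) + inf (B v).
Proof. by apply: least_constant_le; apply: BD; exact: least_constant. Qed.

Let least_constantZ_le a v : inf (B (a *: v)) <= `|a| * inf (B v).
Proof. by apply: least_constant_le; apply: BZ; exact: least_constant. Qed.

Lemma least_constantZ a v : inf (B (a *: v)) = `|a| * inf (B v).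
Proof.
have [->|a0] := eqVneq a 0.
  apply/eqP; rewrite eq_le least_constantZ_le normr0 mul0r/=.
  exact: B_ge0 (least_constant _).
apply/eqP; rewrite eq_le least_constantZ_le/=.
have := least_constantZ_le a^-1 (a *: v).
by rewrite scalerK// normfV ler_pdivlMl ?normr_gt0.
Qed.

Lemma least_constant_eq0 v : inf (B v) = 0 -> v = 0.
Proof. by move=> v0; apply: B_eq0; rewrite -[X in B _ X]v0; exact: least_constant. Qed.

End least_constant.

Section Lip0.
Context (R : realType) (X : metricType R).

Definition lip_constants (f : X -> R) : set R :=
  [set k | 0 <= k /\ forall x y, `|f x - f y| <= k * mdist x y].

Definition lip0_pred (x0 : X) : {pred X -> R} :=
  [pred f | `[< f x0 = 0 /\ lip_constants f !=set0 >]].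

Lemma lip0_predP (x0 : X) f :
  reflect (f x0 = 0 /\ lip_constants f !=set0) (f \in lip0_pred x0).
Proof. exact: asboolP. Qed.

Record Lip0 (x0 : X) := MkLip0 {
  Lip0_fun :> X -> R ;
  Lip0_funP : Lip0_fun \in lip0_pred x0 }.

Variable x0 : X.

HB.instance Definition _ := [isSub for @Lip0_fun x0].
HB.instance Definition _ := [Choice of Lip0 x0 by <:].

Let lip_constantsD f g k l : lip_constants f k -> lip_constants g l ->
  lip_constants (f + g) (k + l).
Proof.
move=> [k0 fk] [l0 gl]; split=> [|x y]; first exact: addr_ge0.
rewrite -[_ - _]/(f x + g x - (f y + g y)) opprD addrACA mulrDl.
by rewrite (le_trans (ler_normD _ _))// lerD.
Qed.

Let lip_constantsZ a f k : lip_constants f k ->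
  lip_constants (a *: f) (`|a| * k).
Proof.
move=> [k0 fk]; split=> [|x y]; first exact: mulr_ge0.
by rewrite -[_ - _]/(a * f x - a * f y) -mulrBr normrM -mulrA ler_wpM2l.
Qed.

Let lip0_submod_closed : submod_closed (lip0_pred x0).
Proof.
split=> [|a f g].
  apply/lip0_predP; split=> //; exists 0; split=> // x y.
  by rewrite subrr normr0 mul0r.
move=> /lip0_predP[f0 [k fk]] /lip0_predP[g0 [l gl]]; apply/lip0_predP; split.
  by rewrite -[LHS]/(a * f x0 + g x0) f0 g0 mulr0 addr0.
by exists (`|a| * k + l); apply: lip_constantsD => //; exact: lip_constantsZ.
Qed.

HB.instance Definition _ :=
  GRing.isSubmodClosed.Build _ _ (lip0_pred x0) lip0_submod_closed.
HB.instance Definition _ := [SubChoice_isSubLmodule of Lip0 x0 by <:].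

Definition lip_norm (f : Lip0 x0) : R := inf (lip_constants f).

Let B (f : Lip0 x0) : set R := lip_constants f.

Let B_neq0 f : B f !=set0.
Proof. by have /lip0_predP[] := Lip0_funP f. Qed.

Let B_ge0 f k : B f k -> 0 <= k. Proof. by case. Qed.

Let BP f k : 0 <= k -> (forall e, 0 < e -> B f (k + e)) -> B f k.
Proof.
move=> k0 fk; split=> // x y.
have [->|xy] := eqVneq x y; first by rewrite subrr normr0 mulr_ge0 ?mdist_ge0.
have d0 : 0 < mdist x y by rewrite mdist_gt0.
rewrite -ler_pdivrMr//; apply/ler_addgt0Pr => e e0.
by rewrite ler_pdivrMr//; have [_] := fk e e0; exact.
Qed.

Let BS f k l : B f k -> k <= l -> B f l.
Proof.
move=> [k0 fk] kl; split=> [|x y]; first exact: le_trans kl.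
by rewrite (le_trans (fk x y))// ler_wpM2r ?mdist_ge0.
Qed.

Let BD f g k l : B f k -> B g l -> B (f + g) (k + l).
Proof. exact: lip_constantsD. Qed.

Let BZ a f k : B f k -> B (a *: f) (`|a| * k).
Proof. exact: lip_constantsZ. Qed.

Let B_eq0 f : B f 0 -> f = 0.
Proof.
move=> [_ f0]; apply/val_inj/funext => x /=.
have fx0 : f x0 = 0 by have /lip0_predP[] := Lip0_funP f.
by have := f0 x x0; rewrite mul0r fx0 subr0 normr_le0 => /eqP.
Qed.

Let lip_normD (f g : Lip0 x0) : lip_norm (f + g) <= lip_norm f + lip_norm g.
Proof. exact: least_constantD B_neq0 B_ge0 BP BS BD f g. Qed.

Let lip_normZ a (f : Lip0 x0) : lip_norm (a *: f) = `|a| * lip_norm f.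
Proof. exact: least_constantZ B_neq0 B_ge0 BP BS BZ a f. Qed.

Let lip_norm_eq0 (f : Lip0 x0) : lip_norm f = 0 -> f = 0.
Proof. exact: (least_constant_eq0 B_neq0 B_ge0 BP BS B_eq0). Qed.

HB.instance Definition _ := Lmodule_isNormed.Build R (Lip0 x0)
  lip_normD lip_normZ lip_norm_eq0.

Lemma lip_normE (f : Lip0 x0) : `|f| = lip_norm f. Proof. by []. Qed.

Lemma lip_normP (f : Lip0 x0) : lip_constants f `|f|.
Proof. exact: least_constant B_neq0 B_ge0 BP BS f. Qed.

End Lip0.

Section dual.
Context (R : realType) (V : normedModType R).

Definition bound_constants (phi : V -> R) : set R :=
  [set k | 0 <= k /\ forall v, `|phi v| <= k * `|v|].

Definition dual_pred : {pred V -> R} :=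
  [pred phi | `[< scalar phi /\ bound_constants phi !=set0 >]].

Lemma dual_predP phi :
  reflect (scalar phi /\ bound_constants phi !=set0) (phi \in dual_pred).
Proof. exact: asboolP. Qed.

Record dual := MkDual {
  dual_fun :> V -> R ;
  dual_funP : dual_fun \in dual_pred }.

HB.instance Definition _ := [isSub for dual_fun].
HB.instance Definition _ := [Choice of dual by <:].

Let bound_constantsD f g k l : bound_constants f k -> bound_constants g l ->
  bound_constants (f + g) (k + l).
Proof.
move=> [k0 fk] [l0 gl]; split=> [|v]; first exact: addr_ge0.
by rewrite mulrDl (le_trans (ler_normD _ _))// lerD.
Qed.

Let bound_constantsZ a f k : bound_constants f k ->
  bound_constants (a *: f) (`|a| * k).
Proof.
move=> [k0 fk]; split=> [|v]; first exact: mulr_ge0.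
by rewrite -[(a *: f) v]/(a * f v) normrM -mulrA ler_wpM2l.
Qed.

Let dual_submod_closed : submod_closed dual_pred.
Proof.
split=> [|a f g].
  apply/dual_predP; split=> [b u v|]; first by rewrite /= mulr0 addr0.
  by exists 0; split=> // v; rewrite normr0 mul0r.
move=> /dual_predP[flin [k fk]] /dual_predP[glin [l gl]]; apply/dual_predP; split.
  move=> b u v; rewrite -[LHS]/(a * f (b *: u + v) + g (b *: u + v)).
  rewrite flin glin -[RHS]/(b * (a * f u + g u) + (a * f v + g v)) !mulrDr.
  by rewrite addrACA mulrCA.
by exists (`|a| * k + l); apply: bound_constantsD => //; exact: bound_constantsZ.
Qed.

HB.instance Definition _ :=
  GRing.isSubmodClosed.Build _ _ dual_pred dual_submod_closed.
HB.instance Definition _ := [SubChoice_isSubLmodule of dual by <:].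

Definition dual_norm (phi : dual) : R := inf (bound_constants phi).

Let B (phi : dual) : set R := bound_constants phi.

Let B_neq0 f : B f !=set0.
Proof. by have /dual_predP[] := dual_funP f. Qed.

Let B_ge0 f k : B f k -> 0 <= k. Proof. by case. Qed.

Let BP f k : 0 <= k -> (forall e, 0 < e -> B f (k + e)) -> B f k.
Proof.
move=> k0 fk; split=> // v.
have [v0|v0] := eqVneq `|v| 0.
  by have [_ /(_ v)] := fk 1 ltr01; rewrite v0 !mulr0.
have d0 : 0 < `|v| by rewrite lt_neqAle eq_sym v0/=.
rewrite -ler_pdivrMr//; apply/ler_addgt0Pr => e e0.
by rewrite ler_pdivrMr//; have [_] := fk e e0; exact.
Qed.

Let BS f k l : B f k -> k <= l -> B f l.
Proof.
move=> [k0 fk] kl; split=> [|v]; first exact: le_trans kl.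
by rewrite (le_trans (fk v))// ler_wpM2r.
Qed.

Let BD f g k l : B f k -> B g l -> B (f + g) (k + l).
Proof. exact: bound_constantsD. Qed.

Let BZ a f k : B f k -> B (a *: f) (`|a| * k).
Proof. exact: bound_constantsZ. Qed.

Let B_eq0 f : B f 0 -> f = 0.
Proof.
move=> [_ f0]; apply/val_inj/funext => v /=.
by have := f0 v; rewrite mul0r normr_le0 => /eqP.
Qed.

Let dual_normD (f g : dual) : dual_norm (f + g) <= dual_norm f + dual_norm g.
Proof. exact: least_constantD B_neq0 B_ge0 BP BS BD f g. Qed.

Let dual_normZ a (f : dual) : dual_norm (a *: f) = `|a| * dual_norm f.
Proof. exact: least_constantZ B_neq0 B_ge0 BP BS BZ a f. Qed.

Let dual_norm_eq0 (f : dual) : dual_norm f = 0 -> f = 0.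
Proof. exact: (least_constant_eq0 B_neq0 B_ge0 BP BS B_eq0). Qed.

HB.instance Definition _ := Lmodule_isNormed.Build R dual
  dual_normD dual_normZ dual_norm_eq0.

Lemma dual_normE (f : dual) : `|f| = dual_norm f. Proof. by []. Qed.

Lemma dual_normP (f : dual) : bound_constants f `|f|.
Proof. exact: least_constant B_neq0 B_ge0 BP BS f. Qed.

End dual.

Section linear_span.
Context (R : realType) (V : lmodType R).

Definition linear_span (A : set V) : set V :=
  [set v | exists n (a : 'I_n -> R) (u : 'I_n -> V),
    (forall i, A (u i)) /\ v = \sum_(i < n) a i *: u i].

End linear_span.

Section free_space.
Context (R : realType) (X : metricType R) (x0 : X).

Let evaluation_in_dual (x : X) :
  (fun f : Lip0 x0 => f x) \in @dual_pred R (Lip0 x0).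
Proof.
apply/dual_predP; split=> //; exists (mdist x x0).
split=> [|f]; first exact: mdist_ge0.
have /lip0_predP[fx0 _] := Lip0_funP f.
have [_ /(_ x x0)] := lip_normP f.
by rewrite fx0 subr0 mulrC.
Qed.

Definition evaluation (x : X) : dual (Lip0 x0) := MkDual (evaluation_in_dual x).

Definition free_space : set (dual (Lip0 x0)) :=
  closure (linear_span (range evaluation)).

End free_space.
Arguments free_space {R X} x0.

Section linfty_sum.
Context (R : realType) (I : Type) (V : I -> normedModType R).

Record linfty_sum := MkLinfty {
  linfty_fun :> forall i, V i ;
  linfty_bounded : has_ubound (range (fun i => `|linfty_fun i|)) }.

HB.instance Definition _ := gen_eqMixin linfty_sum.
HB.instance Definition _ := gen_choiceMixin linfty_sum.

Lemma linfty_eqP (u v : linfty_sum) : (forall i, u i = v i) -> u = v.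
Proof.
case: u v => [u bu] [v bv] /= uv.
have {}uv : u = v by exact: functional_extensionality_dep.
by move: bu; rewrite uv => bu; congr MkLinfty; exact: Prop_irrelevance.
Qed.

Let bounded0 : has_ubound (range (fun i => `|0 : V i|)).
Proof. by exists 0 => _ [i _ <-]; rewrite normr0. Qed.

Let boundedN (u : linfty_sum) : has_ubound (range (fun i => `|- u i|)).
Proof.
have [k uk] := linfty_bounded u.
by exists k => _ [i _ <-]; rewrite normrN; apply: uk; exists i.
Qed.

Let boundedD (u v : linfty_sum) : has_ubound (range (fun i => `|u i + v i|)).
Proof.
have [k uk] := linfty_bounded u; have [l vl] := linfty_bounded v.
exists (k + l) => _ [i _ <-]; rewrite (le_trans (ler_normD _ _))// lerD//.
  by apply: uk; exists i.
by apply: vl; exists i.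
Qed.

Let boundedZ a (u : linfty_sum) : has_ubound (range (fun i => `|a *: u i|)).
Proof.
have [k uk] := linfty_bounded u.
exists (`|a| * k) => _ [i _ <-]; rewrite normrZ ler_wpM2l//.
by apply: uk; exists i.
Qed.

Let zero := MkLinfty bounded0.
Let opp u := MkLinfty (boundedN u).
Let add u v := MkLinfty (boundedD u v).
Let scale a u := MkLinfty (boundedZ a u).

Let addA : associative add.
Proof. by move=> u v w; apply: linfty_eqP => i /=; exact: addrA. Qed.
Let addC : commutative add.
Proof. by move=> u v; apply: linfty_eqP => i /=; exact: addrC. Qed.
Let add0 : left_id zero add.
Proof. by move=> u; apply: linfty_eqP => i /=; exact: add0r. Qed.
Let addN : left_inverse zero opp add.
Proof. by move=> u; apply: linfty_eqP => i /=; exact: addNr. Qed.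

HB.instance Definition _ :=
  GRing.isZmodule.Build linfty_sum addA addC add0 addN.

Let scaleA a b u : scale a (scale b u) = scale (a * b) u.
Proof. by apply: linfty_eqP => i /=; exact: scalerA. Qed.
Let scale1 : left_id 1 scale.
Proof. by move=> u; apply: linfty_eqP => i /=; exact: scale1r. Qed.
Let scaleDr : right_distributive scale +%R.
Proof. by move=> a u v; apply: linfty_eqP => i /=; exact: scalerDr. Qed.
Let scaleDl u : {morph scale^~ u : a b / a + b}.
Proof. by move=> a b; apply: linfty_eqP => i /=; exact: scalerDl. Qed.

HB.instance Definition _ :=
  GRing.Zmodule_isLmodule.Build R linfty_sum scaleA scale1 scaleDr scaleDl.

(* The supremum of the empty set is 0, so this is right for empty [I] too. *)
Definition linfty_norm (u : linfty_sum) : R := sup (range (fun i => `|u i|)).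

Let linfty_norm_ub (u : linfty_sum) i : `|u i| <= linfty_norm u.
Proof. by apply: ub_le_sup; [exact: linfty_bounded|exists i]. Qed.

Let linfty_norm0 (u : linfty_sum) : ~ inhabited I -> linfty_norm u = 0.
Proof.
move=> I0; have u0 : range (fun i => `|u i|) = set0.
  by apply/seteqP; split=> // t [i _ _]; case: I0; exact: inhabits i.
by rewrite /linfty_norm u0 sup0.
Qed.

Let linfty_norm_ge0 (u : linfty_sum) : 0 <= linfty_norm u.
Proof.
have [i|I0] := pselect (inhabited I).
  by case: i => i; exact: le_trans (normr_ge0 (u i)) (linfty_norm_ub u i).
by rewrite linfty_norm0.
Qed.

Let linfty_norm_lub (u : linfty_sum) k :
  0 <= k -> (forall i, `|u i| <= k) -> linfty_norm u <= k.
Proof.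
move=> k0 uk; have [i|I0] := pselect (inhabited I).
  by apply: ge_sup => [|_ [j _ <-]//]; case: i => i; exists `|u i|, i.
by rewrite linfty_norm0.
Qed.

Let linfty_normD u v : linfty_norm (u + v) <= linfty_norm u + linfty_norm v.
Proof.
apply: linfty_norm_lub => [|i]; first exact: addr_ge0.
by rewrite (le_trans (ler_normD _ _))// lerD.
Qed.

Let linfty_normZ_le a u : linfty_norm (a *: u) <= `|a| * linfty_norm u.
Proof.
apply: linfty_norm_lub => [|i]; first exact: mulr_ge0.
by rewrite normrZ ler_wpM2l ?normr_ge0 ?linfty_norm_ub.
Qed.

Let linfty_normZ a u : linfty_norm (a *: u) = `|a| * linfty_norm u.
Proof.
apply/eqP; rewrite eq_le linfty_normZ_le/=.
have [->|a0] := eqVneq a 0; first by rewrite normr0 mul0r.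
have := linfty_normZ_le a^-1 (a *: u).
by rewrite scalerK// normfV ler_pdivlMl ?normr_gt0.
Qed.

Let linfty_norm_eq0 u : linfty_norm u = 0 -> u = 0.
Proof.
move=> u0; apply: linfty_eqP => i; apply/eqP.
by rewrite -normr_le0 -u0 linfty_norm_ub.
Qed.

HB.instance Definition _ := Lmodule_isNormed.Build R linfty_sum
  linfty_normD linfty_normZ linfty_norm_eq0.

Lemma linfty_normE (u : linfty_sum) : `|u| = linfty_norm u. Proof. by []. Qed.

End linfty_sum.

Section l1_sum.
Context (R : realType) (N : set nat) (V : N -> normedModType R).

Definition zero_extension (a : N -> R) : R^nat :=
  fun n => if insub n is Some i then a i else 0.

Definition l1_sum (P : forall n : N, set (dual (V n))) :
    set (forall n : N, dual (V n)) :=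
  [set phi | (forall n, P n (phi n)) /\
             cvgn (series (zero_extension (fun n => `|phi n|)))].

(* [(phi n)_n] in the l^1-sum acts on the l^oo-sum by
   [u |-> \sum_(n in N) phi n (u n)]. *)
Definition l1_sum_functionals (P : forall n : N, set (dual (V n))) :
    set (dual (linfty_sum V)) :=
  [set Phi | exists2 phi, l1_sum P phi & forall u : linfty_sum V,
    series (zero_extension (fun n => phi n (u n))) @ \oo --> Phi u].

End l1_sum.

Section weak_star.
Context (R : realType).

(* The topology on [V] induced by a predual is that of pointwise convergence
   on the functionals, elements of [dual V], that the predual provides. *)
Definition weak_star (V : normedModType R) (P : set (dual V)) : Type :=
  initial_topology (fun v : V => (fun phi : P => val phi v) : {ptws P -> R}).

HB.instance Definition _ (V : normedModType R) (P : set (dual V)) :=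
  Topological.on (weak_star P).

Definition bounded_operator (V W : normedModType R) (T : V -> W) :=
  exists k : R, forall v, `|T v| <= k * `|v|.

Definition weak_star_isomorphism (V W : normedModType R)
    (P : set (dual V)) (Q : set (dual W)) (T : {linear V -> W}) :=
  [/\ bounded_operator T,
      exists S : W -> V, [/\ cancel T S, cancel S T & bounded_operator S] &
      continuous (T : weak_star P -> weak_star Q)].

Definition weak_star_isomorphic (V W : normedModType R)
    (P : set (dual V)) (Q : set (dual W)) :=
  exists T : {linear V -> W}, weak_star_isomorphism P Q T.

End weak_star.

(* Main.v *)
From HB Require Import structures.
Require Import Defs.
From mathcomp Require Import all_boot all_order all_algebra.
From mathcomp Require Import all_classical all_reals all_analysis.

Set Implicit Arguments.
Unset Strict Implicit.
Unset Printing Implicit Defensive.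

Import Order.TTheory GRing.Theory Num.Theory.
Import numFieldNormedType.Exports.

Local Open Scope classical_set_scope.
Local Open Scope ring_scope.

(** The isomorphism restricts to the pieces and moves the basepoints:
    [T f = (f|X_n - f (b_n))_n].  Restriction does not increase Lipschitz
    constants, so [T] has norm at most 1.

    Conversely, a function that is [M]-Lipschitz on every piece is
    [C * M]-Lipschitz on [X] ([piecewise_lipschitz]): two points are joined by
    a decomposition path whose length is at most [C] times their distance, and
    each step of that path stays inside one piece.  This has two uses.  Applied
    to [f] itself, with [M = |T f|], it gives [|f| <= C * |T f|], hence
    injectivity of [T] and boundedness of its inverse.  For surjectivity, a
    bounded family [(g_n)_n] is glued into one function on [X]: the piece [X_n]
    meets the union of the earlier ones in the single point [p_n], so adding a
    constant to [g_n] makes it agree with what has already been built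
    ([gluing]); the outcome is Lipschitz by [piecewise_lipschitz].

    For the weak* topologies it suffices that [T] pulls functionals of the
    predual of the target back to functionals of the predual of the source
    ([weak_star_continuous]).  On one piece the adjoint of the restriction sends
    the evaluation at [x] to the difference of the evaluations at [x] and at
    [b_n], and hence the free space of [X_n] into that of [X], because it is
    continuous ([adjoint_restriction_free_space]).  For an [l^1] family
    [(phi_n)_n] the pullbacks of the partial sums converge in norm, and the free
    space of [X] is closed ([pullback_l1_sum]). *)

(** * Closed linear spans *)

Section linear_span_closure.
Context (R : realType) (V : normedModType R).
Implicit Types (A : set V) (u v : V).

Lemma closure_approxP A v :
  closure A v <-> forall e, 0 < e -> exists2 a, A a & `|v - a| < e.
Proof.
split=> [Av e e0|Av B /nbhs_ballP[e /= e0 eB]].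
  by have [a [Aa]] := Av _ (nbhsx_ballx v _ e0); rewrite -ball_normE; exists a.
have [a Aa va] := Av e e0; exists a; split=> //.
by apply: eB; rewrite -ball_normE.
Qed.

Lemma linear_span0 A : linear_span A 0.
Proof. by exists 0%N, (fun=> 0), (fun=> 0); split=> [[]//|]; rewrite big_ord0. Qed.

Lemma linear_spanD A u v :
  linear_span A u -> linear_span A v -> linear_span A (u + v).
Proof.
move=> [m [c [w [Aw ->]]]] [n [d [z [Az ->]]]].
pose e (i : 'I_(m + n)) := match fintype.split i with inl j => c j | inr j => d j end.
pose t (i : 'I_(m + n)) := match fintype.split i with inl j => w j | inr j => z j end.
exists (m + n)%N, e, t; split=> [i|]; first by rewrite /t; case: fintype.split.
rewrite big_split_ord /=; congr (_ + _); apply: eq_bigr => i _; rewrite /e /t.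
  by rewrite (unsplitK (inl i)).
by rewrite (unsplitK (inr i)).
Qed.

Lemma linear_spanZ A r u : linear_span A u -> linear_span A (r *: u).
Proof.
move=> [m [c [w [Aw ->]]]]; exists m, (fun i => r * c i), w; split=> //.
by rewrite scaler_sumr; apply: eq_bigr => i _; rewrite scalerA.
Qed.

Lemma linear_span_generator A v : A v -> linear_span A v.
Proof. by exists 1%N, (fun=> 1), (fun=> v); rewrite big_ord1 scale1r. Qed.

Lemma closure_linear_span_sum A (n : nat) (w : nat -> V) :
  (forall i, closure (linear_span A) (w i)) ->
  closure (linear_span A) (\sum_(0 <= i < n) w i).
Proof.
move=> Aw; elim: n => [|n IHn].
  by rewrite big_geq//; apply: subset_closure; exact: linear_span0.
rewrite big_nat_recr//=; apply/closure_approxP => e e0.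
have e20 : 0 < e / 2 by rewrite divr_gt0.
have [a Aa ua] := (closure_approxP _ _).1 IHn _ e20.
have [c Ac uc] := (closure_approxP _ _).1 (Aw n) _ e20.
exists (a + c); first exact: linear_spanD.
by rewrite opprD addrACA (le_lt_trans (ler_normD _ _))// (splitr e) ltrD.
Qed.

End linear_span_closure.

(** * Adjoints of contractions *)

Section dual_norm.
Context (R : realType) (V : normedModType R).

Lemma dual_norm_le (phi : dual V) k :
  0 <= k -> (forall v, `|phi v| <= k * `|v|) -> `|phi| <= k.
Proof.
by move=> k0 phik; rewrite dual_normE; apply: ge_inf; [exists 0 => ? []|].
Qed.

Lemma le_dual_norm (phi : dual V) v :
  `|phi v| <= `|phi| * `|v|.
Proof. by have [_] := dual_normP phi. Qed.

End dual_norm.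

Section adjoint.
Context (R : realType) (V W : normedModType R).

Variable T : {linear V -> W}.
Hypothesis T1 : forall v, `|T v| <= `|v|.

Let adjoint_subproof (phi : dual W) : (fun v => phi (T v)) \in @dual_pred R V.
Proof.
apply/dual_predP; split=> [a u v|].
  rewrite linearP; have /dual_predP[+ _] := dual_funP phi; exact.
exists `|phi|; split=> // v; rewrite (le_trans (le_dual_norm _ _))//.
by rewrite ler_wpM2l.
Qed.

Definition adjoint phi : dual V := MkDual (adjoint_subproof phi).

Lemma adjointP a phi psi :
  adjoint (a *: phi + psi) = a *: adjoint phi + adjoint psi.
Proof. by apply/val_inj. Qed.

HB.instance Definition _ :=
  GRing.isLinear.Build R (dual W) (dual V) _ adjoint adjointP.

Lemma le_adjoint phi : `|adjoint phi| <= `|phi|.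
Proof.
apply: dual_norm_le => // v /=.
by rewrite (le_trans (le_dual_norm _ _))// ler_wpM2l.
Qed.

Lemma adjoint_closure_linear_span (A : set (dual W)) (B : set (dual V)) :
  (forall phi, A phi -> linear_span B (adjoint phi)) ->
  forall phi, closure (linear_span A) phi ->
    closure (linear_span B) (adjoint phi).
Proof.
move=> AB phi /closure_approxP Aphi; apply/closure_approxP => e e0.
have [psi [n [c [w [Aw psiE]]]] lte] := Aphi e e0.
exists (adjoint psi); last by rewrite -linearB (le_lt_trans (le_adjoint _)).
rewrite psiE linear_sum /=; elim/big_ind : _ => [|u v|i _].
- exact: linear_span0.
- exact: linear_spanD.
- by rewrite linearZ; apply: linear_spanZ; exact: AB.
Qed.

End adjoint.

(** * Continuity for weak* topologies *)

Lemma weak_star_functional_continuous (R : realType) (V : normedModType R)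
    (P : set (dual V)) (phi : dual V) :
  P phi -> continuous (phi : weak_star P -> R).
Proof.
move=> Pphi v.
have cvgv : (fun (u : V) (psi : P) => val psi u) @ (v : weak_star P) -->
    ((fun psi : P => val psi v) : {ptws P -> R}).
  exact: (@initial_continuous V {ptws P -> R}).
apply: ((pointwise_cvgP _ _).1 cvgv (exist _ phi (mem_set Pphi))).
exact: (@fmap_filter _ _ _ (nbhs (v : weak_star P))).
Qed.

(** A weak* topology is initial for its functionals, so continuity of [T] can be
    tested on the compositions [Phi \o T]. *)
Lemma weak_star_continuous (R : realType) (V W : normedModType R)
    (P : set (dual V)) (Q : set (dual W)) (T : V -> W) :
  (forall Phi, Q Phi -> exists2 phi, P phi & forall v, phi v = Phi (T v)) ->
  continuous (T : weak_star P -> weak_star Q).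
Proof.
move=> QP; apply: continuous_comp_initial => v; apply/pointwise_cvgP.
  exact: (@fmap_filter _ _ _ (nbhs (v : weak_star P))).
move=> [Phi PhiQ]; have [phi Pphi phiE] := QP Phi (set_mem PhiQ).
have := weak_star_functional_continuous Pphi (x := v).
by have -> : (phi : weak_star P -> R) = Phi \o T by exact/funext.
Qed.

(** * Restriction of Lipschitz functions to a subset *)

Section lip_norm.
Context (R : realType) (X : metricType R) (x0 : X).

Lemma Lip0_base (f : Lip0 x0) : f x0 = 0.
Proof. by have /lip0_predP[] := Lip0_funP f. Qed.

Lemma lip_norm_ub (f : Lip0 x0) x y : `|f x - f y| <= `|f| * mdist x y.
Proof. by have [_] := lip_normP f. Qed.

Lemma lip_norm_le (f : Lip0 x0) k :
  0 <= k -> (forall x y, `|f x - f y| <= k * mdist x y) -> `|f| <= k.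
Proof.
by move=> k0 fk; rewrite lip_normE; apply: ge_inf; [exists 0 => ? []|].
Qed.

Definition Lip0_of_lipschitz (f : X -> R) (k : R) (f0 : f x0 = 0) (k0 : 0 <= k)
    (fk : forall x y, `|f x - f y| <= k * mdist x y) : Lip0 x0 :=
  MkLip0 (introT (lip0_predP x0 f) (conj f0 (ex_intro _ k (conj k0 fk)))).

End lip_norm.

Section restriction.
Context (R : realType) (X : metricType R) (x0 : X) (A : set X) (a : A).

Let restriction_lip (f : Lip0 x0) (x y : A) :
  `|f (val x) - f (val a) - (f (val y) - f (val a))| <= `|f| * mdist x y.
Proof. by rewrite opprB addrA subrK lip_norm_ub. Qed.

(** Subtracting the value at [a] brings the restriction back to the functions
    that vanish at the new basepoint. *)
Definition restriction (f : Lip0 x0) : Lip0 a :=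
  @Lip0_of_lipschitz R A a (fun x => f (val x) - f (val a)) `|f| (subrr _)
    (normr_ge0 _) (restriction_lip f).

Let restrictionP c f g :
  restriction (c *: f + g) = c *: restriction f + restriction g.
Proof.
apply/val_inj/funext => x /=.
rewrite -[LHS]/(c * f (val x) + g (val x) - (c * f (val a) + g (val a))).
rewrite -[RHS]/(c * (f (val x) - f (val a)) + (g (val x) - g (val a))).
by rewrite mulrBr opprD addrACA.
Qed.

HB.instance Definition _ :=
  GRing.isLinear.Build R (Lip0 x0) (Lip0 a) _ restriction restrictionP.

Lemma le_restriction f : `|restriction f| <= `|f|.
Proof. by apply: lip_norm_le => // x y; exact: restriction_lip. Qed.

(** The adjoint sends the evaluation at [x] to the evaluation at [x] minus the one
    at [a], which lies in the span of the evaluations on [X]. *)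
Lemma adjoint_restriction_free_space (phi : dual (Lip0 a)) :
  free_space a phi -> free_space x0 (adjoint le_restriction phi).
Proof.
apply: adjoint_closure_linear_span => _ [x _ <-].
have -> : adjoint le_restriction (evaluation a x) =
    (evaluation x0 (val x)) + (-1) *: evaluation x0 (val a).
  by apply/val_inj/funext => f /=; rewrite -[RHS]/(f _ + -1 * f _) mulN1r.
apply: linear_spanD; first by apply: linear_span_generator; exists (val x).
by apply: linear_spanZ; apply: linear_span_generator; exists (val a).
Qed.

End restriction.

(** * Families of contractions and the l^oo-sum *)

Section linfty.
Context (R : realType) (I : Type) (V : I -> normedModType R).

Lemma linfty_norm_ub (u : linfty_sum V) i : `|u i| <= `|u|.
Proof.
by rewrite linfty_normE; apply: ub_le_sup; [exact: linfty_bounded|exists i].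
Qed.

Lemma linfty_norm_le (u : linfty_sum V) k :
  0 <= k -> (forall i, `|u i| <= k) -> `|u| <= k.
Proof.
move=> k0 uk; rewrite linfty_normE /linfty_norm.
have [->|/set0P ne] := eqVneq (range (fun i => `|u i|)) set0; first by rewrite sup0.
by apply: ge_sup => // _ [i _ <-].
Qed.

Lemma has_ubound_norms (u : forall i, V i) k :
  (forall i, `|u i| <= k) -> has_ubound (range (fun i => `|u i|)).
Proof. by move=> uk; exists k => _ [i _ <-]. Qed.

Context (U : normedModType R) (T : forall i, {linear U -> V i}).
Hypothesis T1 : forall i v, `|T i v| <= `|v|.

Definition linfty_prod (v : U) : linfty_sum V :=
  MkLinfty (has_ubound_norms (fun i => T1 i v)).

Let linfty_prodP c u v :
  linfty_prod (c *: u + v) = c *: linfty_prod u + linfty_prod v.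
Proof. by apply: linfty_eqP => i; exact: linearP. Qed.

HB.instance Definition _ :=
  GRing.isLinear.Build R U (linfty_sum V) _ linfty_prod linfty_prodP.

Lemma le_linfty_prod v : `|linfty_prod v| <= `|v|.
Proof. by apply: linfty_norm_le => // i; exact: T1. Qed.

End linfty.

(** * Pulling back the l^1-sum of the preduals *)

Section pullback.
Context (R : realType) (N : set nat) (V : N -> normedModType R).
Context (U : normedModType R) (T : forall i, {linear U -> V i}).
Hypothesis T1 : forall i v, `|T i v| <= `|v|.
Context (A : set (dual U)) (P : forall i, set (dual (V i))).
Hypothesis PA : forall i phi,
  P phi -> closure (linear_span A) (adjoint (T1 i) phi).

(** An element of the [l^1]-sum is given as a pointwise limit of partial sums.
    Since [\sum_n |phi_n|] converges, the partial sums of the pullbacks are Cauchy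
    for the dual norm, so the pointwise limit is a limit in norm, which stays in
    the closed span. *)
Lemma pullback_l1_sum (Phi : dual (linfty_sum V)) :
  l1_sum_functionals P Phi ->
  closure (linear_span A) (adjoint (le_linfty_prod T1) Phi).
Proof.
move=> [phi [Pphi phi_cvg] PhiE].
pose psi n : dual U :=
  if insub n is Some i then adjoint (T1 i) (phi i) else 0.
pose c := zero_extension (fun i => `|phi i|).
have Apsi n : closure (linear_span A) (psi n).
  rewrite /psi; case: insub => [i|]; first exact: PA.
  by apply: subset_closure; exact: linear_span0.
have psi_le n v : `|psi n v| <= c n * `|v|.
  rewrite /psi /c /zero_extension; case: insub => [i|]; last first.
    by rewrite mul0r -[X in `|X|]/(0 : R) normr0.
  rewrite (le_trans (le_dual_norm _ _))// ler_wpM2r//; exact: le_adjoint.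
have psiE n v : psi n v = zero_extension (fun i => phi i (T i v)) n.
  by rewrite /psi /zero_extension; case: insub.
have psi_series n v : (\sum_(0 <= k < n) psi k) v =
    series (zero_extension (fun i => phi i (T i v))) n.
  rewrite seriesEnat /=; elim: n => [|n IHn]; first by rewrite !big_geq.
  by rewrite !big_nat_recr//= -IHn -psiE.
suff approx e : 0 < e -> exists n,
    `|adjoint (le_linfty_prod T1) Phi - \sum_(0 <= k < n) psi k| <= e.
  rewrite ((closure_id _).1 (@closed_closure _ (linear_span A))).
  apply/closure_approxP => e e0; have e20 : 0 < e / 2 by rewrite divr_gt0.
  have [n le_e] := approx _ e20.
  exists (\sum_(0 <= k < n) psi k); first exact: closure_linear_span_sum.
  by rewrite (le_lt_trans le_e)// ltr_pdivrMr// ltr_pMr// ltr1n.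
move=> e0.
have /cauchy_cvgP/cauchy_seriesP/(_ e e0) := phi_cvg.
case=> -[B1 B2] /= [[n1 _ Bn1] [n2 _ Bn2]] tail.
pose M := maxn n1 n2; exists M.
apply: dual_norm_le => [|v]; first exact: ltW.
rewrite -[dual_fun _ v]/(Phi (linfty_prod T1 v) - (\sum_(0 <= k < M) psi k) v).
(* For fixed [v] the bound on the tail from [M] to [n] is uniform in [n], so it
   passes to the limit. *)
have cvg_norm_diff : `|series (zero_extension (fun i => phi i (T i v))) n -
    (\sum_(0 <= k < M) psi k) v| @[n --> \oo] -->
    `|Phi (linfty_prod T1 v) - (\sum_(0 <= k < M) psi k) v|.
  apply: cvg_norm; apply: cvgB; last exact: cvg_cst.
  exact: (PhiE (linfty_prod T1 v)).
rewrite -(cvg_lim _ cvg_norm_diff)//.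
apply: limr_le; first by apply/cvg_ex; eexists; exact: cvg_norm_diff.
exists M => // n /= Mn; rewrite psi_series sub_series_geq//.
under eq_bigr do rewrite -psiE.
rewrite (le_trans (ler_norm_sum _ _ _))//.
rewrite (le_trans (ler_sum _ (fun k _ => psi_le k v)))// -mulr_suml ler_wpM2r//.
have /tail/ltW : (B1 `*` B2) (M, n).
  split => /=; [apply: Bn1; exact: leq_maxl|apply: Bn2].
  by rewrite /= (leq_trans _ Mn)// leq_maxr.
by apply: le_trans; exact: ler_norm.
Qed.

End pullback.

(** * Lipschitz functions on a tree-like decomposition *)

Section gluing.
Context (R : realType) (X : metricType R) (N : set nat) (Xs : nat -> set X).

(** Join [x] to [y] by a path of length at most [C * mdist x y] whose steps stay
    inside the pieces, and telescope [F] along it. *)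
Lemma piecewise_lipschitz C (F : X -> R) M :
  geometric_decomposition_with N Xs C -> 1 <= C -> 0 <= M ->
  (forall n x y, N n -> Xs n x -> Xs n y -> `|F x - F y| <= M * mdist x y) ->
  forall x y, `|F x - F y| <= C * M * mdist x y.
Proof.
move=> [_ _ short] C1 M0 FM x y; have C0 : 0 < C by exact: lt_le_trans C1.
have [z [_ zx zy _ zstep] zlen] := short x y.
rewrite ler_pdivrMl// in zlen.
rewrite mulrAC [_ * M]mulrC; apply: le_trans (ler_wpM2l M0 zlen).
rewrite distrC -[X in F X - _]zy -[X in _ - F X]zx.
rewrite -(telescope_sumr (fun i => F (nth x z i)))// big_mkord mulr_sumr.
apply: le_trans (ler_norm_sum _ _ _) (ler_sum _ _) => i _.
by have [n [Nn zi zSi]] := zstep _ (ltn_ord i); rewrite distrC; exact: FM zi zSi.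
Qed.

Variables (p : nat -> X) (g : nat -> X -> R).

(** The function [g j] is shifted by the constant that makes it agree at [p j] with
    what the earlier pieces determine.  The result is meaningful on the first [k]
    pieces only. *)
Fixpoint partial_gluing k x : R :=
  if k is j.+1 then
    if `[< (\bigcup_(m < j) Xs m) x >] then partial_gluing j x
    else g j x - g j (p j) + partial_gluing j (p j)
  else 0.

Lemma partial_gluing_stable j k x : (j <= k)%N -> (\bigcup_(m < j) Xs m) x ->
  partial_gluing k x = partial_gluing j x.
Proof.
move=> + xj; elim: k => [|k IHk]; first by rewrite leqn0 => /eqP ->.
rewrite leq_eqVlt => /predU1P[<-//|jk] /=.
rewrite ifT; first exact: IHk.
by apply/asboolP; case: xj => m /= mj xm; exists m => //=; exact: leq_trans mj _.
Qed.

(** Each piece after the first meets the earlier ones in its branch point alone,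
    where its shifted function takes the value already chosen: so on [Xs n] the
    result differs from [g n] by a constant. *)
Lemma gluing : tree_like_decomposition N Xs ->
  (forall n, N n -> (0 < n)%N -> meets_previous_at Xs n (p n)) ->
  exists F : X -> R, forall n x y, N n -> Xs n x -> Xs n y ->
    F x - F y = g n x - g n y.
Proof.
move=> [_ XsT _] pP.
have /choice[idx idxP] : forall x, exists n, N n /\ Xs n x.
  by move=> x; have : setT x by []; rewrite -XsT => -[n Nn xn]; exists n.
exists (fun x => partial_gluing (idx x).+1 x) => n.
have FE x : N n -> Xs n x -> partial_gluing (idx x).+1 x =
    g n x - g n (p n) + partial_gluing n (p n).
  move=> Nn xn.
  (* The piece [idx x] selected for [x] may come before or after [Xs n]. *)
  have -> : partial_gluing (idx x).+1 x = partial_gluing n.+1 x.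
    have [_ xi] := idxP x.
    case/orP: (leq_total (idx x) n) => le_n.
      by rewrite -(@partial_gluing_stable (idx x).+1 n.+1)//; exists (idx x) => /=.
    by rewrite (@partial_gluing_stable n.+1 (idx x).+1)//; exists n => /=.
  rewrite /=; case: asboolP => // xprev.
  have n0 : (0 < n)%N by case: xprev => m /= mn _; exact: leq_ltn_trans mn.
  have -> : x = p n.
    have : [set p n] x by rewrite -(pP n Nn n0).
    by [].
  by rewrite subrr add0r.
move=> x y Nn xn yn; rewrite !FE// opprD addrACA subrr addr0.
by rewrite opprB addrA subrK.
Qed.

End gluing.

(** * The isomorphism *)

Theorem theorem5 (R : realType) (X : metricType R) (x0 : X)
    (N : set nat) (Xs : nat -> set X) (b : forall n : N, Xs (val n)) :
  geometric_decomposition N Xs ->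
  weak_star_isomorphic
    (free_space x0)
    (l1_sum_functionals (fun n : N => free_space (b n))).
Proof.
move=> [C C1 geo].
have [tree _ _] := geo.
pose V (n : N) : normedModType R := Lip0 (b n).
pose r (n : N) : {linear Lip0 x0 -> V n} := restriction (b n).
(* The proof is kept transparent, because adjoints of [r n] depend on it. *)
pose r1 n : forall f, `|r n f| <= `|f| := @le_restriction R X x0 _ (b n).
pose T : {linear Lip0 x0 -> linfty_sum V} := linfty_prod r1.
have le_T f : `|f| <= C * `|T f|.
  apply: lip_norm_le => [|x y]; first by rewrite mulr_ge0// (le_trans _ C1).
  apply: (piecewise_lipschitz geo) => // {x y} n x y Nn xn yn.
  pose i : N := exist _ n (mem_set Nn).
  pose w z (zn : Xs n z) : Xs (val i) := exist _ z (mem_set zn).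
  have := lip_norm_ub (T f i) (w x xn) (w y yn).
  rewrite -[X in `|X|]/(f x - f (val (b i)) - (f y - f (val (b i)))).
  rewrite opprB addrA subrK => /le_trans -> //.
  by rewrite ler_wpM2r ?mdist_ge0//; exact: (linfty_norm_ub (T f) i).
have T_inj : injective T.
  move=> f h Tfh; apply/eqP; rewrite -subr_eq0 -normr_le0.
  by rewrite (le_trans (le_T _))// linearB Tfh subrr normr0 mulr0.
have T_surj u : exists f, T f = u.
  have [p pP] : exists p : nat -> X,
      forall n, N n -> (0 < n)%N -> meets_previous_at Xs n (p n).
    have [_ _ meets] := tree.
    suff /choice[p pP] : forall n, exists q,
        N n -> (0 < n)%N -> meets_previous_at Xs n q by exists p.
    move=> n; have [Nn|Nn] := pselect (N n /\ (0 < n)%N); last first.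
      by exists x0 => ? ?; case: Nn.
    by have [q qP] := meets n Nn.1 Nn.2; exists q.
  (* The functions [u i] live on subtypes: extend them by 0 to [X], and the family
     by 0 to the indices outside [N]. *)
  pose g n (x : X) : R := if insub n is Some i then
    if insub x is Some w then (u i : Lip0 (b i)) w else 0 else 0.
  have gE (i : N) (w : Xs (val i)) : g (val i) (val w) = (u i : Lip0 (b i)) w.
    by rewrite /g valK valK.
  have [F FE] := gluing g tree pP.
  have F_lip x y : `|F x - F y| <= C * `|u| * mdist x y.
    apply: (piecewise_lipschitz geo) => // {x y} n x y Nn xn yn.
    pose i : N := exist _ n (mem_set Nn).
    pose w z (zn : Xs n z) : Xs (val i) := exist _ z (mem_set zn).
    rewrite (FE n)// (gE i (w x xn)) (gE i (w y yn)).
    rewrite (le_trans (lip_norm_ub _ _ _))// ler_wpM2r ?mdist_ge0//.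
    exact: (linfty_norm_ub u i).
  have Cu0 : 0 <= C * `|u| by rewrite mulr_ge0// (le_trans _ C1).
  have F0_lip x y : `|F x - F x0 - (F y - F x0)| <= C * `|u| * mdist x y.
    by rewrite opprB addrA subrK.
  exists (@Lip0_of_lipschitz R X x0 (fun x => F x - F x0) _ (subrr _) Cu0 F0_lip).
  apply: linfty_eqP => i; apply/val_inj/funext => w.
  rewrite -[LHS]/(F (val w) - F x0 - (F (val (b i)) - F x0)).
  rewrite opprB addrA subrK (FE (val i)); [|exact: set_valP..].
  by rewrite !gE Lip0_base subr0.
have /choice[S TS] := T_surj.
exists T; split.
- by exists 1 => f; rewrite mul1r; exact: le_linfty_prod.
- exists S; split=> [f|//|]; first by apply: T_inj.
  by exists C => u; rewrite (le_trans (le_T _))// TS.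
- apply: weak_star_continuous => Phi PhiQ.
  exists (adjoint (le_linfty_prod r1) Phi) => //.
  apply: pullback_l1_sum PhiQ => i phi; exact: adjoint_restriction_free_space.
Qed.
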